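(* For every pair of functions $t_1=t_1(n)$ and $t_2=t_2(n)$ with $t_1\in\Omega(n^{1/2})$, $t_2\in O(n)$ and $t_1\ll t_2$, there exists a graph sequence $\mathcal{G}=(G_1,\ldots,G_n,\ldots)$, where $G_n$ is a connected graph on $n$ vertices, such that $\tau(\mathcal{G})\subset\Omega(t_1)\cap O(t_2)$.
   Context: Pebbling: let $G=(V,E)$ be a connected graph on $n$ vertices. A configuration $C$ of $t$ pebbles on $G$ is a multiset of $t$ elements of $V$. A pebbling step removes two pebbles from a vertex $v$ and places one pebble on a neighbor of $v$. $C$ is $r$-solvable if at least one pebble can be placed on the vertex $r$ by a (possibly empty) sequence of pebbling steps, and solvable if it is $r$-solvable for every $r\in V$. A random configuration of $t$ pebbles is chosen uniformly from all $\binom{n+t-1}{t}$ configurations (multisets). Threshold: for a graph sequence $\mathcal{G}=(G_1,\ldots,G_n,\ldots)$, where $G_n$ has $n$ vertices, a function $t=t(n)$ is a threshold of $\mathcal{G}$ if, as $n\to\infty$: (1) for every $s_1\ll t$ the probability that a random configuration of $s_1$ pebbles on $G_n$ is solvable tends to $0$; and (2) for every $s_2\gg t$ the probability that a random configuration of $s_2$ pebbles on $G_n$ is solvable tends to $1$. $\tau(\mathcal{G})$ denotes the set of all threshold functions of $\mathcal{G}$ (it is known to be nonempty for every such $\mathcal{G}$). Numbers of pebbles are integers. Notation (for positive functions of $n$): $f\ll g$ (equivalently $g\gg f$) means $f(n)/g(n)\to0$ as $n\to\infty$; $f\in O(g)$ (resp. $f\in\Omega(g)$) means there are positive constants $c,k$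 with $f(n)<c\,g(n)$ (resp. $f(n)>c\,g(n)$) for all $n>k$. *)

(* Defs.v *)
From mathcomp Require Import all_boot all_order all_algebra.
From mathcomp Require Import all_classical all_reals all_analysis.
From Stdlib Require Import Relation_Operators.
Set Implicit Arguments.
Unset Strict Implicit.
Unset Printing Implicit Defensive.
Import Order.TTheory GRing.Theory Num.Theory.
Import numFieldNormedType.Exports.
Local Open Scope classical_set_scope.
Local Open Scope ring_scope.

Record sgraph := SGraph {
  vertex :> finType;
  edge : rel vertex;
  edge_sym : symmetric edge;
  edge_irrefl : irreflexive edge }.

Definition connected_graph (G : sgraph) : Prop :=
  forall x y : G, connect (@edge G) x y.

Section Pebbling.
Variable G : sgraph.

(* A multiset of vertices is given by its multiplicity function. *)
Definition pebbling_step (C D : {ffun G -> nat}) : Prop :=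
  exists v w : G, [/\ edge v w, (2 <= C v)%N &
    D = [ffun x => (C x - 2 * (x == v) + (x == w))%N]].

Definition solvable_at (C : {ffun G -> nat}) (r : G) : Prop :=
  exists2 D, clos_refl_trans _ pebbling_step C D & (0 < D r)%N.

Definition pebbling_solvable (C : {ffun G -> nat}) : Prop :=
  forall r : G, solvable_at C r.

(* In a multiset of size t every multiplicity is at most t, so multisets of
   size t form a finite set of functions into 'I_t.+1. *)
Definition configs (t : nat) : {set {ffun G -> 'I_t.+1}} :=
  [set C : {ffun G -> 'I_t.+1} | (\sum_v C v)%N == t]%SET.

Definition config_fun (t : nat) (C : {ffun G -> 'I_t.+1}) : {ffun G -> nat} :=
  [ffun v => nat_of_ord (C v)].

Definition solvable_configs (t : nat) : {set {ffun G -> 'I_t.+1}} :=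
  [set C in configs t | `[< pebbling_solvable (config_fun C) >]]%SET.

Definition prob_solvable (R : realType) (t : nat) : R :=
  #|solvable_configs t|%:R / #|configs t|%:R.

End Pebbling.

Section Asymptotics.
Variable R : realType.
Implicit Types f g : nat -> R.

(* Functions of n are considered for n >= 1 only; values at 0 are junk. *)
Definition positive_fun f : Prop := forall n, (0 < n)%N -> 0 < f n.

Definition much_less f g : Prop := (fun n => f n / g n) @ \oo --> (0 : R).

Definition O_class g : set (nat -> R) :=
  [set f | exists (c : R) (k : nat), [/\ 0 < c, (0 < k)%N &
    forall n, (k < n)%N -> f n < c * g n]].

Definition Omega_class g : set (nat -> R) :=
  [set f | exists (c : R) (k : nat), [/\ 0 < c, (0 < k)%N &
    forall n, (k < n)%N -> c * g n < f n]].

End Asymptotics.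

(* The index 0 is a placeholder: the sequence proper is G 1, G 2, ... *)
Definition graph_sequence (G : nat -> sgraph) : Prop :=
  forall n, (0 < n)%N -> connected_graph (G n) /\ #|G n| = n.

(* A threshold may be real-valued, while the numbers of pebbles s are natural
   numbers; they are positive, which the total division in much_less needs. *)
Definition is_threshold (R : realType) (G : nat -> sgraph) (t : nat -> R) :
    Prop :=
  [/\ positive_fun t,
    forall s : nat -> nat, (forall n, (0 < n)%N -> (0 < s n)%N) ->
      much_less (fun n => (s n)%:R) t ->
      (fun n => prob_solvable (G n) R (s n)) @ \oo --> (0 : R) &
    forall s : nat -> nat, (forall n, (0 < n)%N -> (0 < s n)%N) ->
      much_less t (fun n => (s n)%:R) ->
      (fun n => prob_solvable (G n) R (s n)) @ \oo --> (1 : R)].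

Definition thresholds (R : realType) (G : nat -> sgraph) : set (nat -> R) :=
  [set t | is_threshold G t].

(* Main.v *)
Require Import Defs.
From mathcomp Require Import all_boot all_order all_algebra.
From mathcomp Require Import all_classical all_reals all_analysis.
From mathcomp Require Import zify ring lra.
From Stdlib Require Import Relation_Operators.
Set Implicit Arguments.
Unset Strict Implicit.
Unset Printing Implicit Defensive.
Import Order.TTheory GRing.Theory Num.Theory.
Import numFieldNormedType.Exports.

(** The graphs are brooms: a path 0 - 1 - ... - l (the handle), all other
    vertices (the bristles) being leaves attached to 0.  Solving for the far
    end l costs 2 ^ l pebbles at 0.  If there are a pebbles on n vertices with a
    at most of order n, about a ^ 2 / n bristles carry two pebbles or more, and
    each of them can send one pebble to 0.  So a broom is typically solvable
    once a ^ 2 is a large multiple of n 2 ^ l, and typically not when a ^ 2 is a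
    small multiple of it: its threshold is sqrt (n 2 ^ l), which covers the
    whole range from sqrt n to n as l varies.  Choosing 2 ^ l of order
    t1 ^ 2 / n + 1 puts the threshold between t1 and t2.

    Not solvable ([few_solvable]).  The sum of 2 ^ i C(i) over the handle plus
    the number of disjoint pairs of pebbles on single bristles never increases
    ([potential_step]) and is at least 2 ^ l when the end of the handle can be
    reached; Markov's inequality bounds the probability of this event.

    Solvable ([many_solvable]).  The number of bristles with two pebbles or
    more has a variance bounded by its mean, because the numbers of
    configurations form a log-concave sequence, so Chebyshev's inequality
    applies ([few_poor_configs]).

    All counts of configurations come from one bijection: removing a pebbles
    from v identifies the configurations of t + a pebbles having at least a
    pebbles on v with the configurations of t pebbles ([sum_configs_shift]).

    Together ([broom_window]) these give, for numbers of pebbles a <= b that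
    are comparable to t1 and t2, a probability at most 1/2 at a and at least
    1/2 at b.  A threshold t that is not in Omega(a) has a / t unbounded;
    taking s = a along a subsequence where a / t diverges, and some s >> t
    elsewhere, contradicts the second clause of the definition of a threshold
    ([threshold_Omega]); the upper bound is symmetric ([threshold_O]). *)

(** * Counting configurations *)

Section CountingConfigurations.
Local Open Scope nat_scope.
Variable G : sgraph.
Implicit Types (v w : G) (t a : nat).

Definition add_pebbles (C : {ffun G -> nat}) a v : {ffun G -> nat} :=
  [ffun x => C x + a * (x == v)].

(** Removing and adding a pebbles on v are mutually inverse. *)
Lemma sum_configs_shift v t a (f : {ffun G -> nat} -> nat) :
  \sum_(C in configs G (t + a) | a <= C v) f (config_fun C) =
  \sum_(C in configs G t) f (add_pebbles (config_fun C) a v).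
Proof.
pose up (C : {ffun G -> 'I_t.+1}) : {ffun G -> 'I_(t + a).+1} :=
  [ffun x => inord (C x + a * (x == v))].
pose down (C : {ffun G -> 'I_(t + a).+1}) : {ffun G -> 'I_t.+1} :=
  [ffun x => inord (C x - a * (x == v))].
have upE C x : up C x = C x + a * (x == v) :> nat.
  rewrite ffunE inordK // ltnS leq_add //; first by rewrite -ltnS.
  by case: (x == v); rewrite ?muln1 ?muln0.
have le_others (C : {ffun G -> 'I_(t + a).+1}) x :
    C \in configs G (t + a) -> a <= C v -> C x - a * (x == v) <= t.
  rewrite inE => /eqP sumC aC; case: eqVneq => [->|xv].
    by rewrite muln1; have := ltn_ord (C v); lia.
  have : C x + C v <= \sum_y C y.
    by rewrite (bigD1 x) //= leq_add2l (bigD1 v) 1?eq_sym //= leq_addr.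
  by rewrite sumC muln0; lia.
rewrite (reindex_onto up down) => [|C /andP[Ct aC]]; last first.
  apply/ffunP => x; apply: val_inj; rewrite /= upE ffunE inordK ?ltnS ?le_others //.
  rewrite subnK //; case: eqVneq => [->|_]; by rewrite ?muln1 ?muln0.
apply: eq_big => [C|C _]; last first.
  by congr (f _); apply/ffunP => x; rewrite ffunE upE !ffunE.
have -> : down (up C) = C.
  apply/ffunP => x; apply: val_inj; rewrite /= ffunE upE addnK.
  by rewrite inordK.
rewrite eqxx upE eqxx muln1 leq_addl !andbT !inE.
under eq_bigr do rewrite upE.
rewrite big_split /= -big_distrr /= (bigD1 v (F := fun x => (x == v : nat))) //=.
rewrite eqxx [\sum_(i | i != v) _]big1 => [|x xv]; first by rewrite addn0 muln1 eqn_add2r.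
by rewrite (negbTE xv).
Qed.

Definition total_at v t := \sum_(C in configs G t) config_fun C v.
Definition total_half_at v t := \sum_(C in configs G t) (config_fun C v)./2.

Lemma card_configs_ge v t a :
  #|[set C in configs G (t + a) | a <= C v]%SET| = #|configs G t|.
Proof.
rewrite -!sum1_card -(sum_configs_shift v _ a (fun _ => 1)).
by apply: eq_bigl => C; rewrite inE.
Qed.

(** Shifting at v leaves the pebbles on w alone, so two shifts compose. *)
Lemma card_configs_ge2 v w t a : v != w ->
  #|[set C in configs G (t + a + a) | (a <= C v) && (a <= C w)]%SET|
  = #|configs G t|.
Proof.
move=> vw; rewrite -(card_configs_ge w t a) -!sum1dep_card.
transitivity (\sum_(C in configs G (t + a + a) | a <= C v)
    (a <= config_fun C w : nat)).
  rewrite [RHS]big_mkcond /= [LHS]big_mkcond /=; apply: eq_bigr => C _.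
  by rewrite ffunE; case: (C \in _); case: (a <= C v); case: (a <= C w).
rewrite (sum_configs_shift v _ a (fun C => (a <= C w) : nat)).
rewrite [RHS]big_mkcond /= [LHS]big_mkcond /=; apply: eq_bigr => C _.
rewrite !ffunE eq_sym (negbTE vw) muln0 addn0.
by case: (C \in _); case: (_ <= _).
Qed.

Lemma total_atS v t : total_at v t.+1 = total_at v t + #|configs G t|.
Proof.
have -> : total_at v t.+1 = total_at v (t + 1) by rewrite addn1.
rewrite /total_at (bigID (fun C : {ffun G -> 'I_(t + 1).+1} => 1 <= C v)) /=.
rewrite (sum_configs_shift v _ 1 (fun C => C v)) [X in _ + X]big1 ?addn0; last first.
  by move=> C /andP[_]; rewrite ffunE -leqNgt leqn0 => /eqP.
rewrite -sum1_card -big_split; apply: eq_bigr => C _ /=.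
by rewrite !ffunE eqxx.
Qed.

Lemma total_half_atSS v t :
  total_half_at v t.+2 = total_half_at v t + #|configs G t|.
Proof.
have -> : total_half_at v t.+2 = total_half_at v (t + 2) by rewrite addn2.
rewrite /total_half_at (bigID (fun C : {ffun G -> 'I_(t + 2).+1} => 2 <= C v)) /=.
rewrite (sum_configs_shift v _ 2 (fun C => (C v)./2)) [X in _ + X]big1 ?addn0.
  rewrite -sum1_card -big_split; apply: eq_bigr => C _ /=.
  by rewrite !ffunE eqxx muln1 halfD /= andbF addn1.
by move=> C /andP[_]; rewrite ffunE -ltnNge; case: (nat_of_ord _) => [|[]].
Qed.

Lemma sum_total_at t : \sum_v total_at v t = t * #|configs G t|.
Proof.
rewrite exchange_big /= mulnC -sum_nat_const; apply: eq_bigr => C.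
by rewrite inE => /eqP {2}<-; apply: eq_bigr => v _; rewrite ffunE.
Qed.

(** Double counting of pairs of a configuration and one of its pebbles; it
    amounts to the closed formula binomial (n + t - 1, t). *)
Lemma card_configsS t :
  t.+1 * #|configs G t.+1| = (#|G| + t) * #|configs G t|.
Proof.
rewrite -sum_total_at; under eq_bigr do rewrite total_atS.
by rewrite big_split /= sum_total_at sum_nat_const -mulnDl addnC.
Qed.

Lemma card_configs0 : 0 < #|configs G 0|.
Proof.
apply/card_gt0P; exists [ffun=> ord0]; rewrite inE.
by apply/eqP/big1 => v _; rewrite ffunE.
Qed.

Lemma total_at0 v : total_at v 0 = 0.
Proof. by apply: big1 => C _; rewrite ffunE ord1. Qed.

Lemma card_configs_gt0 t : 0 < #|G| -> 0 < #|configs G t|.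
Proof.
move=> n0; elim: t => [|t IHt]; first exact: card_configs0.
have : 0 < t.+1 * #|configs G t.+1| by rewrite card_configsS muln_gt0 IHt addn_gt0 n0.
by rewrite muln_gt0 => /andP[].
Qed.

Lemma total_atE v t : #|G| * total_at v t = t * #|configs G t|.
Proof.
elim: t => [|t IHt]; first by rewrite total_at0 muln0.
by rewrite total_atS mulnDr IHt card_configsS addnC -mulnDl.
Qed.

Lemma card_configsSS t : t.+2 * t.+1 * #|configs G t.+2| =
  (#|G| + t.+1) * (#|G| + t) * #|configs G t|.
Proof. by have := card_configsS t; have := card_configsS t.+1; nia. Qed.

(** The expected number of disjoint pairs of pebbles on v is at most
    t (t - 1) / (n (n + 1)), with n the number of vertices: induction on t with
    step 2, as removing two pebbles from v removes exactly one pair. *)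
Lemma total_half_at_le v t :
  #|G| * #|G|.+1 * total_half_at v t <= t * t.-1 * #|configs G t|.
Proof.
elim/ltn_ind: t => -[|[|t]] IHt.
- by rewrite /total_half_at big1 ?muln0 // => C _; rewrite ffunE ord1.
- rewrite /total_half_at big1 ?muln0 // => C _.
  by rewrite ffunE; case: (C v) => -[|[|]].
rewrite total_half_atSS [t.+2.-1]/= card_configsSS mulnDr.
apply: leq_trans (_ : t * t.-1 * #|configs G t| +
  #|G| * #|G|.+1 * #|configs G t| <= _).
  by rewrite leq_add2r IHt.
by rewrite -mulnDl leq_mul2r; apply/orP; right; nia.
Qed.

(* log-concavity *)
(** The ratio of consecutive terms, (n + t) / (t + 1), is nonincreasing in t. *)
Lemma card_configs_log_concave t : 0 < #|G| ->
  #|configs G t.+2| * #|configs G t| <= #|configs G t.+1| ^ 2.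
Proof.
move=> n0; have := card_configsS t; have := card_configsS t.+1.
move: #|configs G t.+2| #|configs G t.+1| #|configs G t| => a b c ab bc.
rewrite -(leq_pmul2l (_ : 0 < t.+2 * (#|G| + t))); last by rewrite muln_gt0; lia.
have -> : t.+2 * (#|G| + t) * (a * c) = (t.+2 * a) * ((#|G| + t) * c) by ring.
rewrite ab -bc.
have -> : (#|G| + t.+1) * b * (t.+1 * b) = (#|G| + t.+1) * t.+1 * (b ^ 2) by ring.
by rewrite leq_mul2r; apply/orP; right; nia.
Qed.

End CountingConfigurations.

(** * Second moment of the number of rich vertices *)

Section SecondMoment.
Local Open Scope nat_scope.
Variables (G : sgraph) (A : {set G}).

Definition num_rich (C : {ffun G -> nat}) := \sum_(v in A) (2 <= C v).

Lemma sum_num_rich t :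
  \sum_(C in configs G (t + 2)) num_rich (config_fun C) = #|A| * #|configs G t|.
Proof.
rewrite exchange_big /= -sum_nat_const; apply: eq_bigr => v _.
rewrite -(card_configs_ge v t 2) -sum1dep_card big_mkcondr /=.
by apply: eq_bigr => C _; rewrite ffunE; case: (2 <= C v).
Qed.

(** The diagonal pairs of vertices give the mean, the other ones the second
    term. *)
Lemma sum_num_rich_sq t :
  \sum_(C in configs G (t + 2 + 2)) num_rich (config_fun C) ^ 2 <=
  #|A| * #|configs G (t + 2)| + #|A| ^ 2 * #|configs G t|.
Proof.
under eq_bigr => C _ do rewrite -mulnn /num_rich big_distrlr /=.
rewrite exchange_big /=.
rewrite -mulnn -mulnA -mulnDr -sum_nat_const; apply: leq_sum => v vA.
rewrite exchange_big /= (bigD1 v) //= leq_add //.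
  rewrite -(card_configs_ge v (t + 2) 2) -sum1dep_card big_mkcondr /=.
  by apply/eq_leq/eq_bigr => C _; rewrite ffunE; case: (2 <= C v).
apply: leq_trans (_ : \sum_(w in A | w != v) #|configs G t| <= _); last first.
  by rewrite sum_nat_const leq_mul2r subset_leq_card ?orbT //; apply/fintype.subsetP => w /andP[].
apply: leq_sum => w /andP[_ wv].
rewrite -(card_configs_ge2 t 2 wv) -sum1dep_card big_mkcondr /=.
by apply/eq_leq/eq_bigr => C _; rewrite !ffunE; case: (2 <= C v); case: (2 <= C w).
Qed.

(** This says that the events C v >= 2 for two vertices v are negatively
    correlated. *)
Lemma card_configs_log_concave2 t : 0 < #|G| ->
  #|configs G (t + 2 + 2)| * #|configs G t| <= #|configs G (t + 2)| ^ 2.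
Proof.
move=> n0; have -> : #|configs G (t + 2 + 2)| = #|configs G t.+4| by rewrite !addn2.
have -> : #|configs G (t + 2)| = #|configs G t.+2| by rewrite !addn2.
have := card_configs_log_concave t n0.
have := card_configs_log_concave t.+1 n0.
have := card_configs_log_concave t.+2 n0.
have := card_configs_gt0 t.+2 n0.
move: #|configs G t.+4| #|configs G t.+3| #|configs G t.+2|
  #|configs G t.+1| #|configs G t| => a b c d e c0 ac bd ce.
rewrite -(leq_pmul2l (_ : 0 < c ^ 2)) ?expn_gt0 ?c0 //.
apply: leq_trans (_ : (b * d) ^ 2 <= _); last by rewrite -expnMn leq_exp2r // -mulnn in bd *.
by rewrite expnMn; apply: leq_trans (leq_mul ac ce); apply/eq_leq; ring.
Qed.

(** Chebyshev's inequality without division: with X the number of rich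
    vertices and M / N its mean, sum 4 (N X - M) ^ 2 over all configurations.
    If 2 k is at most the mean, then N X <= M / 2 at every poor configuration,
    so such a term is at least M ^ 2. *)
Lemma few_poor_configs t k : 0 < #|G| -> 4 <= k ->
  2 * k * #|configs G (t + 2 + 2)| <= #|A| * #|configs G (t + 2)| ->
  2 * #|[set C in configs G (t + 2 + 2) | num_rich (config_fun C) < k]%SET|
    <= #|configs G (t + 2 + 2)|.
Proof.
move=> n0 k4; set bad := #|[set _ in _ | _]%SET|.
have := card_configs_log_concave2 t n0.
have N0 := card_configs_gt0 (t + 2 + 2) n0.
have := sum_num_rich_sq t; have := sum_num_rich (t + 2).
set N := #|configs G (t + 2 + 2)| in N0 *.
set M := #|A| * _; set S := \sum_(C in _) _ ^ 2.
move=> sumX sumX2 logc kM.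
have cheb : bad * M ^ 2 + 8 * N * M * M <= 4 * (N ^ 2 * S + N * M ^ 2).
  have -> : N * M ^ 2 = \sum_(C in configs G (t + 2 + 2)) M ^ 2.
    by rewrite sum_nat_const.
  rewrite -[X in _ + _ * X]sumX /S.
  rewrite big_distrr [in leqRHS]big_distrr -big_split big_distrr /=.
  rewrite /bad -sum1dep_card big_distrl big_mkcondr /= -big_split /=.
  apply: leq_sum => C _; set X := num_rich _.
  (* (2 N X - 2 M) ^ 2 >= 0 everywhere, and >= M ^ 2 at poor configurations *)
  have agm : 2 * (N * X * M) <= (N * X) ^ 2 + M ^ 2 by exact: nat_Cauchy.
  case: ltnP => [Xk|_]; last by nia.
  have : 2 * (N * X) <= M by nia.
  have -> : 8 * N * M * X = 8 * M * (N * X) by ring.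
  rewrite -expnMn mul1n; move: (N * X) agm => y agm yM.
  have [d ->] : exists d, M = 2 * y + d by exists (M - 2 * y); lia.
  nia.
have : N ^ 2 * S <= N ^ 2 * M + N * M ^ 2.
  apply: leq_trans (leq_mul (leqnn _) sumX2) _; rewrite mulnDr leq_add2l.
  rewrite expnMn; nia.
move=> sumle.
have M0 : 8 * N <= M by apply: leq_trans kM; rewrite leq_mul2r; lia.
have badM : bad * M * M <= 4 * N ^ 2 * M by rewrite -mulnA mulnn; lia.
have {}badM : bad * M <= 4 * N ^ 2 by rewrite leq_pmul2r in badM; lia.
have : bad * (8 * N) <= 4 * N ^ 2 by apply: leq_trans badM; rewrite leq_mul2l M0 orbT.
by rewrite -mulnn => badN; rewrite -(leq_pmul2r (_ : 0 < 4 * N)); lia.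
Qed.
End SecondMoment.

(** * Moving pebbles along edges *)

Section Moves.
Local Open Scope nat_scope.
Variable G : sgraph.
Implicit Types (v w c : G) (C D : {ffun G -> nat}).

Definition reachable := clos_refl_trans _ (@pebbling_step G).

Lemma edge_neq v w : edge v w -> v != w.
Proof. by apply: contraTneq => ->; rewrite edge_irrefl. Qed.

Lemma move_pebbles v w k C : edge v w -> 2 * k <= C v ->
  exists2 D, reachable C D &
    C w + k <= D w /\ (forall x, x != v -> x != w -> D x = C x).
Proof.
move=> vw; have vNw := edge_neq vw.
elim: k C => [|k IHk] C Cv; first by exists C; [exact: rt_refl | rewrite addn0].
pose C1 : {ffun G -> nat} := [ffun x => C x - 2 * (x == v) + (x == w)].
have stepC : pebbling_step C C1 by exists v, w; split=> //; lia.
have C1v : 2 * k <= C1 v by rewrite ffunE eqxx (negbTE vNw); lia.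
have C1w : C1 w = (C w).+1.
  by rewrite ffunE eqxx eq_sym (negbTE vNw) muln0 subn0 addn1.
have [D CD [Dw Dx]] := IHk C1 C1v; exists D; last split.
- by apply: rt_trans CD; apply: rt_step.
- by lia.
- by move=> x xv xw; rewrite Dx // ffunE (negbTE xv) (negbTE xw) muln0 subn0 addn0.
Qed.

(** One move from each of the rich neighbours; a move into c does not disturb
    the others because c is not its own neighbour. *)
Lemma gather_pebbles c (s : seq G) C : uniq s ->
  {in s, forall v, edge v c /\ 2 <= C v} ->
  exists2 D, reachable C D & C c + size s <= D c.
Proof.
elim: s C => [|v s IHs] C /=; first by exists C; [exact: rt_refl | rewrite addn0].
move=> /andP[vs us] richs.
have [vc Cv] : edge v c /\ 2 <= C v by apply: richs; rewrite mem_head.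
have [D CD [Dc Dx]] := move_pebbles (k := 1) vc Cv.
have [|E DE Ec] := IHs D us.
  move=> x xs; have [xc Cx] : edge x c /\ 2 <= C x.
    by apply: richs; rewrite inE xs orbT.
  split=> //; rewrite Dx //; last exact: edge_neq.
  by apply: contraNneq vs => <-.
by exists E; [apply: rt_trans DE | lia].
Qed.

End Moves.

(** * Brooms *)

Section Broom.
Local Open Scope nat_scope.

(** The broom is the tree in which every vertex other than 0 is joined to its
    parent.  Parents have smaller indices, which makes induction available. *)
Definition broom_parent (l j : nat) := if j <= l then j.-1 else 0.

Lemma broom_parent_lt l j : 0 < j -> broom_parent l j < j.
Proof. by rewrite /broom_parent; case: ifP => _; lia. Qed.

Definition broom_edge l n : rel 'I_n := fun i j =>
  (0 < j) && (i == broom_parent l j :> nat) ||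
  (0 < i) && (j == broom_parent l i :> nat).

Lemma broom_edge_sym l n : symmetric (@broom_edge l n).
Proof. by move=> i j; rewrite /broom_edge orbC. Qed.

Lemma broom_edge_irrefl l n : irreflexive (@broom_edge l n).
Proof.
move=> i; rewrite /broom_edge orbb; apply/negbTE/negP => /andP[i0 /eqP iE].
by have := broom_parent_lt l i0; rewrite -iE ltnn.
Qed.

Definition broom l n : sgraph :=
  SGraph (@broom_edge_sym l n) (@broom_edge_irrefl l n).

Lemma card_broom l n : #|broom l n| = n.
Proof. exact: card_ord. Qed.

Variables (l n : nat).
Notation B := (broom l n.+1).
Implicit Types (i j v w : B) (C D : {ffun B -> nat}).
Let center : B := ord0.

Lemma broom_parent_vertex v : 0 < v -> exists2 w : B, edge w v & w = broom_parent l v :> nat.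
Proof.
move=> v0; have pv := broom_parent_lt l v0.
exists (Ordinal (ltn_trans pv (ltn_ord v))) => //.
by rewrite /edge /= /broom_edge v0 eqxx.
Qed.

Lemma broom_connected : connected_graph B.
Proof.
have to_center v : connect (@edge B) center v.
  have [k] := ubnP (v : nat); elim: k v => // k IHk v vk.
  case: (posnP v) => [v0|v0].
    by have -> : v = center by apply: val_inj.
  have [w wv wE] := broom_parent_vertex v0.
  apply: connect_trans (connect1 wv); apply: IHk.
  by rewrite wE; have := broom_parent_lt l v0; lia.
move=> x y; apply: connect_trans (to_center y).
by rewrite (sym_connect_sym (@edge_sym B)).
Qed.

Definition broom_depth (j : nat) := if j <= l then j else 1.

(** Every step towards v costs half of the pebbles. *)
Lemma broom_reach v k C : k * 2 ^ broom_depth v <= C center ->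
  exists2 D, reachable C D & k <= D v.
Proof.
have [m] := ubnP (v : nat); elim: m v k C => // m IHm v k C vm kC.
case: (posnP v) => [v0|v0].
  exists C; first exact: rt_refl.
  have -> : v = center by apply: val_inj.
  by rewrite (leq_trans _ kC) // leq_pmulr // expn_gt0.
have [w wv wE] := broom_parent_vertex v0.
have dvE : broom_depth v = (broom_depth w).+1.
  rewrite /broom_depth wE /broom_parent; case: (leqP v l) => // vl.
  by rewrite (_ : v.-1 <= l) ?prednK //; lia.
have [||D CD Dw] := IHm w (2 * k) C.
- by rewrite wE; have := broom_parent_lt l v0; lia.
- by rewrite dvE expnS in kC; lia.
have [E DE [Ev _]] := move_pebbles wv Dw.
by exists E; [apply: rt_trans DE | lia].
Qed.

Lemma broom_solvable C : 0 < l -> 2 ^ l <= C center -> pebbling_solvable C.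
Proof.
move=> l0 Cc v; apply: (@broom_reach v 1).
rewrite mul1n (leq_trans _ Cc) // leq_exp2l // /broom_depth.
by case: ifP.
Qed.

Definition bristles : {set B} := [set v : B | l < v]%SET.

Lemma card_bristles : #|bristles| = n - l.
Proof.
have -> : n - l = n.+1 - l.+1 by [].
rewrite -[RHS]muln1 -sum_nat_const_nat -sum1_card.
by rewrite [RHS]big_geq_mkord; apply: eq_bigl => v; rewrite inE.
Qed.

Lemma broom_solvable_of_rich C : 0 < l ->
  2 ^ l <= num_rich bristles C -> pebbling_solvable C.
Proof.
move=> l0 rich.
pose s := enum [set v in bristles | 2 <= C v]%SET.
have [||D CD Dc] := @gather_pebbles B center s C.
- exact: enum_uniq.
- move=> v; rewrite mem_enum !inE => /andP[lv ->]; split=> //.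
  by rewrite /edge /= /broom_edge /= /broom_parent (leqNgt v) lv (leq_ltn_trans _ lv).
have : pebbling_solvable D.
  apply: broom_solvable => //; apply: leq_trans (leq_trans rich _) Dc.
  rewrite /num_rich -cardE -sum1dep_card.
  rewrite (leq_trans _ (leq_addl _ _)) // big_mkcondr /=.
  by apply: leq_sum => v _; case: ifP.
move=> solD r; have [E DE Er] := solD r.
by exists E => //; apply: rt_trans DE.
Qed.

(** Counted in units of a pebble at the centre, and with single pebbles on
    bristles ignored since they cannot move. *)
Definition potential C :=
  \sum_(v : B) if v <= l then 2 ^ v * C v else (C v)./2.

(** Going down the handle preserves the potential and going up lowers it.  A
    move from a bristle to 0 trades one pair for one pebble; a move from 0 to a
    bristle loses two units and completes at most one pair. *)
Lemma potential_step C D : pebbling_step C D -> potential D <= potential C.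
Proof.
move=> [v [w [vw Cv ->]]]; have vNw := edge_neq vw.
rewrite /potential (bigD1 v) //= (bigD1 w) 1?eq_sym //=.
rewrite [leqRHS](bigD1 v) //= [X in _ <= _ + X](bigD1 w) 1?eq_sym //= !addnA.
apply: leq_add; last first.
  apply: leq_sum => x /andP[xv xw].
  by rewrite ffunE (negbTE xv) (negbTE xw) muln0 subn0 addn0.
rewrite !ffunE !eqxx (negbTE vNw) [w == v]eq_sym (negbTE vNw).
rewrite muln0 muln1 subn0 addn0 addn1.
have [c ->] : exists c, C v = c.+2 by exists (C v - 2); lia.
rewrite subn2 /=.
move: vw; rewrite /edge /= /broom_edge /broom_parent => /orP[]/andP[gt0 /eqP E].
- move: E; case: (leqP w l) => wl E.
    rewrite E; have -> : w.-1 <= l by lia.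
    have -> : 2 ^ w = 2 * 2 ^ w.-1 by rewrite -expnS prednK.
    nia.
  rewrite E /= expn0 !mul1n uphalfE; lia.
- move: E; case: (leqP v l) => vl E.
    rewrite E; have -> : v.-1 <= l by lia.
    have -> : 2 ^ v = 2 * 2 ^ v.-1 by rewrite -expnS prednK.
    nia.
  by rewrite E /= expn0 !mul1n; lia.
Qed.

Lemma potential_solvable C : l <= n -> pebbling_solvable C -> 2 ^ l <= potential C.
Proof.
move=> ln /(_ (Ordinal (ln : l < n.+1))) [D CD Dl].
have le_pot : potential D <= potential C.
  elim: CD {Dl} => [?? /potential_step // | ? // |x y z _ yx _ zy].
  exact: leq_trans zy yx.
apply: leq_trans le_pot; rewrite /potential (bigD1 (Ordinal (ln : l < n.+1))) //=.
by rewrite leqnn (leq_trans _ (leq_addr _ _)) // leq_pmulr.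
Qed.

Lemma sum_potential_le t : l <= n ->
  n.+1 * n.+2 * \sum_(C in configs B t) potential (config_fun C) <=
  (2 ^ l.+1 * t * n.+2 + n.+1 * t ^ 2) * #|configs B t|.
Proof.
move=> ln; rewrite exchange_big /= (bigID (fun v : B => v <= l)) /= mulnDr mulnDl.
apply: leq_add.
- apply: leq_trans (_ : n.+2 * \sum_(v : B | v <= l) 2 ^ v * (t * #|configs B t|) <= _).
    rewrite [X in X * _]mulnC -mulnA leq_mul2l big_distrr /=.
    apply: leq_sum => v vl; rewrite vl -big_distrr /=.
    by rewrite mulnCA leq_mul2l -(@total_atE B v t) card_broom /total_at leqnn orbT.
  rewrite -big_distrl /=.
  have -> : \sum_(v : B | v <= l) 2 ^ (v : nat) = (2 ^ l.+1).-1.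
    rewrite predn_exp mul1n (big_ord_widen n.+1 (fun i : nat => 2 ^ i)) //.
  rewrite mulnCA -!mulnA leq_mul ?leq_pred //; apply/eq_leq; ring.
- apply: leq_trans (_ : \sum_(v : B | ~~ (v <= l)) t * t.-1 * #|configs B t| <= _).
    rewrite big_distrr /=; apply: leq_sum => v /negbTE->.
    by have := @total_half_at_le B v t; rewrite card_broom.
  apply: leq_trans (_ : \sum_(v : B) t * t.-1 * #|configs B t| <= _).
    by rewrite big_mkcond; apply: leq_sum => v _; case: ifP.
  by rewrite sum_nat_const card_broom mulnA leq_mul2r -mulnn !leq_mul2l leq_pred !orbT.
Qed.

(** Markov's inequality: on m = n + 1 vertices the mean potential is at most
    (2 t / m + t ^ 2 / (m 2 ^ l)) 2 ^ l, and the two terms in parentheses are at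
    most 1/8 and 1/4. *)
Lemma few_solvable t : l <= n ->
  4 * t ^ 2 <= n.+1 * 2 ^ l -> 16 * t <= n.+1 ->
  2 * #|solvable_configs B t| <= #|configs B t|.
Proof.
move=> ln tl tn.
have markov : #|solvable_configs B t| * 2 ^ l <=
    \sum_(C in configs B t) potential (config_fun C).
  rewrite -sum_nat_const big_mkcond [leqRHS]big_mkcond /=; apply: leq_sum => C _.
  rewrite inE; case: ifP => // /andP[-> /asboolP]; exact: potential_solvable.
have := sum_potential_le t ln.
have L0 : 0 < 2 ^ l by rewrite expn_gt0.
rewrite expnS; move: (\sum_(C in _) _) markov tl L0 => S.
move: (2 ^ l) #|solvable_configs B t| #|configs B t| => L s N markov tl L0 SN.
have : n.+1 * n.+2 * (s * L) <= (2 * L * t * n.+2 + n.+1 * t ^ 2) * N.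
  by apply: leq_trans SN; rewrite leq_mul2l markov orbT.
move=> h.
have h2 : 16 * (2 * L * t * n.+2) <= 2 * L * n.+1 * n.+2 by nia.
have h3 : 4 * (n.+1 * t ^ 2) <= n.+1 * n.+2 * L by nia.
have : n.+1 * n.+2 * L * (2 * s) <= n.+1 * n.+2 * L * N.
  move: h h2 h3; set a := 2 * L * t * n.+2; set b := n.+1 * t ^ 2.
  have -> : n.+1 * n.+2 * (s * L) = n.+1 * n.+2 * L * s by ring.
  have -> : 2 * L * n.+1 * n.+2 = 2 * (n.+1 * n.+2 * L) by ring.
  move: (n.+1 * n.+2 * L) => p h h2 h3.
  have : 8 * ((a + b) * N) <= 4 * p * N by rewrite mulnA leq_mul2r; lia.
  nia.
by rewrite leq_pmul2l // !muln_gt0 L0.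
Qed.

(** On m = n + 1 vertices there are at least about m / 2 bristles, and each of
    them is rich with probability at least about t ^ 2 / (4 m ^ 2) since t <= m.
    So the mean number of rich bristles is at least about t ^ 2 / (8 m), which
    is at least 4 * 2 ^ l.  Chebyshev's inequality needs a mean of 2 * 2 ^ l;
    the spare factor 2 absorbs the rounding. *)
Lemma many_solvable t : 2 <= l -> 2 * l <= n -> t <= n.+1 -> 32 * n.+1 * 2 ^ l <= t ^ 2 ->
  #|configs B t| <= 2 * #|solvable_configs B t|.
Proof.
move=> l2 ln tn; have L4 : 4 <= 2 ^ l by rewrite -[4]/(2 ^ 2) leq_exp2l.
case: t tn => [|[|[|[|t]]]]; try nia.
move=> tn tl.
have [u ut] : exists u, t.+4 = u + 2 + 2 by exists t; lia.
rewrite ut in tn tl *.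
have poor := @few_poor_configs B bristles u (2 ^ l).
rewrite card_broom in poor; have {}poor := poor erefl L4.
have enough : 2 * 2 ^ l * #|configs B (u + 2 + 2)| <= #|bristles| * #|configs B (u + 2)|.
  rewrite card_bristles.
  have := @card_configsSS B (u + 2).
  have -> : #|configs B (u + 2).+2| = #|configs B (u + 2 + 2)| by rewrite !addn2.
  rewrite card_broom; move: (2 ^ l) tl #|configs B (u + 2 + 2)| #|configs B (u + 2)|.
  move=> L tl N N2 NN2.
  rewrite -(leq_pmul2l (_ : 0 < (u + 2).+2 * (u + 2).+1)) //.
  have -> : (u + 2).+2 * (u + 2).+1 * (2 * L * N) =
    2 * L * ((n.+1 + (u + 2).+1) * (n.+1 + (u + 2))) * N2.
    by rewrite -[RHS]mulnA -NN2; ring.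
  rewrite [leqRHS]mulnA leq_mul2r; apply/orP; right.
  apply: leq_trans (_ : 8 * L * n.+1 ^ 2 <= _).
    have -> : 8 * L * n.+1 ^ 2 = 2 * L * (4 * n.+1 ^ 2) by ring.
    rewrite leq_mul2l; apply/orP; right; nia.
  rewrite -(leq_pmul2l (_ : 0 < 4)) //.
  apply: leq_trans (_ : n.+1 * (u + 2 + 2) ^ 2 <= _).
    by apply: leq_trans (leq_mul (leqnn n.+1) tl); apply/eq_leq; ring.
  have : n.+1 <= 2 * (n - l).+1 by lia.
  nia.
have {}poor := poor enough.
have : #|configs B (u + 2 + 2)| <= #|solvable_configs B (u + 2 + 2)| +
  #|[set C in configs B (u + 2 + 2) | num_rich bristles (config_fun C) < 2 ^ l]%SET|.
  apply: leq_trans (leq_card_setU _ _); apply: subset_leq_card.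
  apply/fintype.subsetP => C CB; rewrite !inE in CB *; rewrite CB /=.
  case: ltnP => [_|rich]; rewrite ?orbT // orbF; apply/asboolP.
  by apply: broom_solvable_of_rich => //; lia.
lia.
Qed.

End Broom.

Section Window.
Local Open Scope nat_scope.

(** 2 ^ l lies between 4 a ^ 2 / n and 8 a ^ 2 / n + 8: large enough for [a]
    pebbles to be too few, and no larger than needed up to a constant.  The term
    4 ensures l >= 2. *)
Definition handle_length n a := up_log 2 (4 * a ^ 2 %/ n + 4).

Lemma broom_window n a b : 0 < n -> 256 * (a ^ 2 + n) <= b ^ 2 -> b <= n ->
  let G := broom (handle_length n a) n in
  2 * #|solvable_configs G a| <= #|configs G a| /\
  #|configs G b| <= 2 * #|solvable_configs G b|.
Proof.
case: n => // n _ ab bn; set l := handle_length _ _ => G.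
set q := 4 * a ^ 2 %/ n.+1.
have qle : q * n.+1 <= 4 * a ^ 2 by exact: leq_divM.
have ltq : 4 * a ^ 2 < q.+1 * n.+1 by exact: ltn_ceil.
have lgt : q + 4 <= 2 ^ l by exact: up_logP.
have l2 : 2 <= l by rewrite -(leq_exp2l (m := 2)) //; lia.
have lle : 2 ^ l <= 2 * (q + 4).
  have /andP[+ _] := @up_log_bounds 2 (q + 4) isT (ltac:(lia)).
  rewrite -/(handle_length n.+1 a) -/l.
  by move=> ltl; rewrite -[l]prednK ?expnS; lia.
have an : 16 * a <= n.+1.
  rewrite -(@leq_exp2r _ _ 2) // expnMn.
  have : b ^ 2 <= n.+1 ^ 2 by rewrite leq_exp2r.
  by lia.
have lb : 32 * n.+1 * 2 ^ l <= b ^ 2.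
  by move: (2 ^ l) lle => L lle; nia.
have ln : 32 * 2 ^ l <= n.+1.
  have : b ^ 2 <= n.+1 ^ 2 by rewrite leq_exp2r.
  by move: (2 ^ l) lb => L lb; nia.
have lL : l < 2 ^ l by exact: ltn_expl.
by split; [apply: few_solvable | apply: many_solvable]; nia.
Qed.

End Window.

(** * Asymptotics *)

Section Asymptotics.
Local Open Scope classical_set_scope.
Local Open Scope ring_scope.
Variable R : realType.

Lemma cvg_nat_dist (u : nat -> R) (l : R) :
  u @ \oo --> l <->
  forall e, 0 < e -> exists N, forall n, (N < n)%N -> `|l - u n| < e.
Proof.
split=> [/cvgrPdist_lt ul e /ul [N _ Nu]|ul].
  by exists N => n /ltnW; exact: Nu.
apply/cvgrPdist_lt => e /ul [N Nu].
by exists N.+1 => // n; exact: Nu.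
Qed.

Lemma much_lessP (f g : nat -> R) : much_less f g <->
  forall e, 0 < e -> exists N, forall n, (N < n)%N -> `|f n / g n| < e.
Proof.
split=> [/cvg_nat_dist fg e /fg [N Nfg]|fg].
  by exists N => n /Nfg; rewrite sub0r normrN.
by apply/cvg_nat_dist => e /fg [N Nfg]; exists N => n /Nfg; rewrite sub0r normrN.
Qed.

(** B is the range of a sequence f with f k > k and r (f k) > k; beyond the
    maximum of the first values of f, an element of B comes from a large k. *)
Lemma divergent_subset (r : nat -> R) :
  (forall (c : R) k, 0 < c -> exists2 n, (k < n)%N & c <= r n) ->
  exists B : set nat, (forall k, exists2 n, (k < n)%N & B n) /\
    (forall c, exists N, forall n, (N < n)%N -> B n -> c <= r n).
Proof.
move=> unbounded.
have /choice[f fP] : forall k, exists n, (k < n)%N /\ k.+1%:R <= r n.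
  by move=> k; have [//|n kn rn] := unbounded k.+1%:R k; exists n.
exists (range f); split=> [k|c].
  by exists (f k); [case: (fP k) | exists k].
exists (\max_(k < (Num.truncn c).+1) f k)%N => n ltn [k _ fkn]; subst n.
case: (leqP (Num.truncn c).+1 k) => [ck|kc].
  apply: le_trans (proj2 (fP k)); apply/ltW/(lt_le_trans (truncnS_gt c)).
  by rewrite ler_nat ltnW.
by move: ltn; rewrite ltnNge (leq_bigmax (Ordinal kc)).
Qed.

Lemma prob_solvable_le_half (G : sgraph) s : (0 < #|G|)%N ->
  (2 * #|solvable_configs G s| <= #|configs G s|)%N ->
  prob_solvable G R s <= 2^-1.
Proof.
move=> /(card_configs_gt0 s) N0 le2; rewrite /prob_solvable ler_pdivrMr ?ltr0n //.
by have := le2; rewrite -(ler_nat R) natrM; lra.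
Qed.

Lemma prob_solvable_ge_half (G : sgraph) s : (0 < #|G|)%N ->
  (#|configs G s| <= 2 * #|solvable_configs G s|)%N ->
  2^-1 <= prob_solvable G R s.
Proof.
move=> /(card_configs_gt0 s) N0 le2; rewrite /prob_solvable ler_pdivlMr ?ltr0n //.
by have := le2; rewrite -(ler_nat R) natrM; lra.
Qed.

(** With x = t1 n and z = x / c >= sqrt n >= 1, one has a <= x + z and n <= z ^ 2,
    while t1 << t2 gives b >= 16 (x + 2 z); squaring yields the claim. *)
Lemma eventually_window (t1 t2 : nat -> R) (c K : R) (k1 k2 : nat) :
  positive_fun t1 -> positive_fun t2 -> 0 < c -> 0 < K ->
  (forall n, (k1 < n)%N -> c * Num.sqrt n%:R < t1 n) ->
  (forall n, (k2 < n)%N -> t2 n < K * n%:R) ->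
  much_less t1 t2 ->
  let a n := (Num.truncn (t1 n)).+1 in
  let b n := Num.truncn (t2 n / K) in
  exists N, forall n, (N < n)%N ->
    (256 * (a n ^ 2 + n) <= b n ^ 2)%N /\ (b n <= n)%N.
Proof.
move=> t1_pos t2_pos c0 K0 t1c t2K /much_lessP t12 a b.
pose A := 16 * (1 + 2 / c) + 1 / c.
have c'0 : 0 < 1 / c by rewrite divr_gt0.
have A0 : 0 < A by rewrite /A; lra.
have [|N tN] := t12 (K * A)^-1; first by rewrite invr_gt0 mulr_gt0.
exists (maxn N (maxn k1 k2)) => n; rewrite !gtn_max => /and3P[Nn k1n k2n].
have n0 : (0 < n)%N by lia.
have {}t1c := t1c n k1n; have {}t2K := t2K n k2n.
have x0 := t1_pos n n0; have y0 := t2_pos n n0.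
have yx : A * t1 n <= t2 n / K.
  have := tN n Nn; rewrite gtr0_norm ?divr_gt0 // ltr_pdivrMr // invfM.
  rewrite ler_pdivlMr //.
  have -> : K^-1 / A * t2 n = t2 n / (K * A) by rewrite invfM; ring.
  by rewrite ltr_pdivlMr ?mulr_gt0 // => h; apply/ltW; rewrite mulrAC mulrC [A * K]mulrC.
have a_le : (a n)%:R <= t1 n + 1.
  by rewrite /a -natr1 lerD2r truncn_le ltW.
have b_gt : t2 n / K < (b n)%:R + 1 by rewrite natr1; exact: truncnS_gt.
have b_le : (b n)%:R <= t2 n / K by rewrite truncn_le divr_ge0 ?ltW.
have bn : (b n <= n)%N.
  rewrite -(ler_nat R) (le_trans b_le) // ler_pdivrMr // mulrC; exact: ltW.
split=> //.
have r1 : 1 <= Num.sqrt (n%:R : R) by rewrite -[leLHS]sqrtr1; apply: ler_wsqrtr; rewrite ler1n.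
have rn : Num.sqrt (n%:R : R) ^+ 2 = n%:R by rewrite sqr_sqrtr.
move: (Num.sqrt _) r1 rn t1c => r r1 rn t1c.
have rz : r <= t1 n / c by rewrite ler_pdivlMr // mulrC ltW.
have Az : A * t1 n = 16 * (t1 n + 2 * (t1 n / c)) + t1 n / c.
  by rewrite /A; ring.
move: (t1 n / c) rz Az => z rz Az.
rewrite -(ler_nat R) natrM natrD !natrX -rn.
have b16 : 16 * (t1 n + 2 * z) <= (b n)%:R by lra.
have a0 : 0 <= (a n)%:R :> R by [].
have h1 : (a n)%:R ^+ 2 <= (t1 n + z) ^+ 2 by rewrite ler_sqr ?nnegrE; lra.
have h2 : r ^+ 2 <= z ^+ 2 by rewrite ler_sqr ?nnegrE; lra.
have h3 : (16 * (t1 n + 2 * z)) ^+ 2 <= (b n)%:R ^+ 2 by rewrite ler_sqr ?nnegrE; lra.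
have xz : 0 <= t1 n * z by rewrite mulr_ge0; lra.
have zz : 0 <= z * z by rewrite mulr_ge0; lra.
lra.
Qed.

End Asymptotics.

(** * Bounds on thresholds *)

Section Thresholds.
Local Open Scope classical_set_scope.
Local Open Scope ring_scope.
Variables (R : realType) (G : nat -> sgraph) (t : nat -> R).
Hypothesis t_threshold : is_threshold G t.

(** Otherwise let s be equal to [a] on a set where a / t diverges, and larger
    than n t elsewhere: t << s, yet the probability at s is infinitely often at
    most 1/2. *)
Lemma threshold_Omega (a : nat -> nat) (N : nat) :
  (forall n, (0 < n)%N -> (0 < a n)%N) ->
  (forall n, (N < n)%N -> prob_solvable (G n) R (a n) <= 2^-1) ->
  Omega_class (fun n => (a n)%:R) t.
Proof.
move=> a0 half; have [t_pos _ above] := t_threshold.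
apply: contrapT => notOmega.
have [C k C0|B [Binf Bdiv]] := @divergent_subset R (fun n => (a n)%:R / t n).
  apply: contrapT => notC; apply: notOmega; exists C^-1, k.+1; split=> //.
    by rewrite invr_gt0.
  move=> n kn; have tn0 : 0 < t n by apply: t_pos; lia.
  rewrite mulrC ltr_pdivrMr // ltNge -ler_pdivlMl //.
  by apply/negP => Cn; apply: notC; exists n; [lia | rewrite mulrC].
pose s n := if n \in B then a n else (Num.truncn (n%:R * t n)).+1.
have s0 n : (0 < n)%N -> (0 < s n)%N by move=> n0; rewrite /s; case: ifP => // _; exact: a0.
have ts : much_less t (fun n => (s n)%:R).
  apply/much_lessP => e e0; have [M BM] := Bdiv (2 / e).
  exists (maxn M (Num.truncn e^-1).+1) => n; rewrite gtn_max => /andP[Mn en].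
  have n0 : (0 < n)%N by lia.
  have tn0 := t_pos n n0; have sn0 : 0 < (s n)%:R :> R by rewrite ltr0n s0.
  rewrite gtr0_norm ?divr_gt0 // ltr_pdivrMr // mulrC -ltr_pdivrMr //.
  rewrite /s; case: ifPn => [/set_mem nB|_].
    have := BM n Mn nB; rewrite ler_pdivlMr //; apply: lt_le_trans.
    by rewrite mulrC ltr_pM2r // ltr_pMl ?invr_gt0 // ltr1n.
  apply: le_lt_trans (truncnS_gt _); rewrite mulrC ler_pM2r //.
  apply/ltW/(lt_trans (truncnS_gt _)); rewrite ltr_nat; exact: en.
have [M sM] := (cvg_nat_dist _ _).1 (above s s0 ts) 2^-1 ltac:(lra).
have [n nM nB] := Binf (maxn N M); move: nM; rewrite gtn_max => /andP[Nn Mn].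
have := sM n Mn; have := half n Nn; rewrite /s mem_set // ltr_norml; lra.
Qed.

(** The mirror image, with s = 1 off the chosen set.  That s << t there needs t
    to diverge. *)
Lemma threshold_O (b : nat -> nat) (N : nat) :
  (forall c, exists N', forall n, (N' < n)%N -> c <= t n) ->
  (forall n, (N < n)%N -> (0 < b n)%N) ->
  (forall n, (N < n)%N -> 2^-1 <= prob_solvable (G n) R (b n)) ->
  O_class (fun n => (b n)%:R) t.
Proof.
move=> t_oo b0 half; have [t_pos below _] := t_threshold.
apply: contrapT => notO.
have [C k C0|B [Binf Bdiv]] := @divergent_subset R (fun n => t n / (b n)%:R).
  apply: contrapT => notC; apply: notO; exists C, (maxn k N).+1; split=> // n kn.
  have bn0 : 0 < (b n)%:R :> R by rewrite ltr0n b0 //; lia.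
  rewrite ltNge -ler_pdivlMr //.
  by apply/negP => Cn; apply: notC; exists n => //; lia.
pose s n := if (n \in B) && (0 < b n)%N then b n else 1%N.
have s0 n : (0 < n)%N -> (0 < s n)%N by rewrite /s; case: ifP => // /andP[].
have st : much_less (fun n => (s n)%:R) t.
  apply/much_lessP => e e0; have [M BM] := Bdiv (2 / e).
  have [M' tM'] := t_oo (2 / e).
  exists (maxn M M') => n; rewrite gtn_max => /andP[Mn Mn'].
  have n0 : (0 < n)%N by lia.
  have tn0 := t_pos n n0; have sn0 : 0 < (s n)%:R :> R by rewrite ltr0n s0.
  rewrite gtr0_norm ?divr_gt0 // ltr_pdivrMr // mulrC -ltr_pdivrMr //.
  have e2 : e^-1 < 2 / e by rewrite ltr_pMl ?invr_gt0 // ltr1n.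
  rewrite /s; case: ifP => [/andP[/set_mem nB bn0]|_].
    have := BM n Mn nB; rewrite ler_pdivlMr ?ltr0n //; apply: lt_le_trans.
    by rewrite mulrC ltr_pM2r // ltr0n.
  by rewrite mul1r; apply: lt_le_trans (tM' n Mn').
have [M sM] := (cvg_nat_dist _ _).1 (below s s0 st) 2^-1 ltac:(lra).
have [n nM nB] := Binf (maxn N M); move: nM; rewrite gtn_max => /andP[Nn Mn].
have := sM n Mn; have := half n Nn; rewrite /s mem_set // b0 // ltr_norml; lra.
Qed.

End Thresholds.

Local Open Scope classical_set_scope.
Local Open Scope ring_scope.

Theorem mainTheorem2 (R : realType) (t1 t2 : nat -> R)
    (t1_pos : positive_fun t1) (t2_pos : positive_fun t2)
    (t1_Omega : Omega_class (fun n => Num.sqrt (n%:R : R)) t1)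
    (t2_O : O_class (fun n => n%:R) t2)
    (t1_t2 : much_less t1 t2) :
  exists G : nat -> sgraph,
    graph_sequence G /\
    thresholds G `<=` Omega_class t1 `&` O_class t2.
Proof.
have [c [k1 [c0 _ t1c]]] := t1_Omega; have [K [k2 [K0 _ t2K]]] := t2_O.
have := eventually_window t1_pos t2_pos c0 K0 t1c t2K t1_t2.
set a := fun n => (Num.truncn (t1 n)).+1; set b := fun n => Num.truncn (t2 n / K).
move=> [N window].
exists (fun n => broom (handle_length n (a n)) n); split=> [[//|n] _|t t_thr].
  by split; [exact: broom_connected | exact: card_broom].
have OmegaA : Omega_class (fun n => (a n)%:R) t.
  apply: (threshold_Omega t_thr (N := N)) => // n Nn.
  have [ab bn] := window n Nn; have n0 : (0 < n)%N by lia.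
  apply: prob_solvable_le_half; first by rewrite card_broom.
  by have [] := broom_window n0 ab bn.
have [d [k [d0 k0 at_]]] := OmegaA.
(* t is at least of order t1, hence of order sqrt n *)
have t_oo C : exists N', forall n, (N' < n)%N -> C <= t n.
  exists (maxn (maxn k k1) (Num.truncn ((C / (d * c)) ^+ 2)).+1) => n.
  rewrite !gtn_max => /andP[/andP[kn k1n] Cn].
  apply/ltW/(le_lt_trans _ (at_ n kn)); rewrite -ler_pdivrMl //.
  apply/ltW/(le_lt_trans _ (truncnS_gt _))/ltW/(le_lt_trans _ (t1c n k1n)).
  rewrite -ler_pdivrMl // mulrA -invfM mulrC [c * d]mulrC.
  apply: le_trans (ler_norm _) _; rewrite -sqrtr_sqr; apply: ler_wsqrtr.
  by apply/ltW/(lt_trans (truncnS_gt _)); rewrite ltr_nat.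
have OB : O_class (fun n => (b n)%:R) t.
  apply: (threshold_O t_thr (N := N)) => // n Nn; have [ab bn] := window n Nn.
    by rewrite lt0n; apply: contraTneq ab => ->; lia.
  have n0 : (0 < n)%N by lia.
  apply: prob_solvable_ge_half; first by rewrite card_broom.
  by have [] := broom_window n0 ab bn.
split.
  exists d, k; split=> // n kn; apply: le_lt_trans (at_ n kn).
  by rewrite ler_pM2l // ltW // truncnS_gt.
have [d' [k' [d'0 k'0 tb]]] := OB.
exists (d' / K), k'; split=> //; first by rewrite divr_gt0.
move=> n kn; apply: lt_le_trans (tb n kn) _; rewrite -mulrA ler_pM2l //.
by rewrite mulrC truncn_le divr_ge0 ?ltW //; apply: t2_pos; lia.
Qed.
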